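(* The following two assertions are equivalent (i.e. the first is true if and only if the second is true): (i) For every integer $n\ge 3$, $n$ is a prime if and only if $S_{n-1}(n)\equiv -1 \pmod{n}$. (ii) For every integer $n\ge 3$, $n$ is a prime if and only if $2S_n(n)\equiv -n^2\pmod{n^3}$.
   Context: For integers $k\ge 1$ and $n\ge 2$, $S_k(n):=\sum_{i=1}^{n-1} i^k=1^k+2^k+\cdots+(n-1)^k$. Assertion (i) is Giuga's conjecture, which is open; the claim is only the equivalence of (i) and (ii). *)

(* Defs.v *)
From mathcomp Require Import all_boot all_algebra.

Set Implicit Arguments.
Unset Strict Implicit.
Unset Printing Implicit Defensive.

Definition power_sum (k n : nat) : nat := \sum_(1 <= i < n) i ^ k.

(* Main.v *)
Require Import Defs.
From mathcomp Require Import all_boot all_algebra.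
From mathcomp Require Import cyclic ring.

(** For each [n >= 3] separately, the two congruences are equivalent; the reason
    depends on the parity of [n].

    For odd [n], pair the terms [i] and [n - i] of the power sum.  Expanding
    [(n - i) ^ n] to second order in [n] leaves [n ^ 2 * i ^ (n - 1)] modulo
    [n ^ 3]: the zeroth order term cancels against [i ^ n], and the second order
    one vanishes since [n] divides ['C(n, 2)] ([pair_expr_odd]).  Hence
    [2 S_n(n)] is congruent to [n ^ 2 S_(n-1)(n)] modulo [n ^ 3]
    ([double_power_sum_odd]), and cancelling [n ^ 2] turns one congruence into
    the other.

    For even [n >= 4] both congruences fail.  For the first, the same pairing
    shows that [n] divides [2 S_(n-1)(n)] ([dvd_double_power_sum]), so that
    [n / 2 > 1] divides [S_(n-1)(n)] and cannot divide [S_(n-1)(n) + 1].  The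
    second would force [n] to divide [S_n(n)]; but modulo the exact power of 2
    dividing [n], odd bases contribute 1 and even bases 0, so that [S_n(n)] is
    congruent to [n / 2] there ([power_sum_even_ndvd]). *)

Set Implicit Arguments.
Unset Strict Implicit.
Unset Printing Implicit Defensive.

Import GRing.Theory.

Local Open Scope ring_scope.

Lemma power_sumZ k n : (power_sum k n)%:Z = \sum_(1 <= i < n) i%:Z ^+ k.
Proof.
rewrite /power_sum -natz natr_sum.
by apply: eq_bigr => i _; rewrite natrX natz.
Qed.

(** Gauss's trick: adding the sum to its own reversal. *)
Lemma double_power_sum k n :
  2 * (power_sum k n)%:Z = \sum_(1 <= i < n) (i%:Z ^+ k + (n%:Z - i%:Z) ^+ k).
Proof.
rewrite mulr_natl mulr2n power_sumZ big_split /=; congr (_ + _).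
rewrite big_nat_rev /=; apply: eq_big_nat => i /andP[i_gt0 i_lt_n].
by rewrite add1n subSS -subzn // ltnW.
Qed.

(** The witness [r] stands for the tail of the binomial expansion. *)
Lemma exprDn_order2 (R : comNzRingType) (a x : R) n :
  exists r, (a + x) ^+ n.+2 =
    x ^+ n.+2 + a * x ^+ n.+1 *+ n.+2 + a ^+ 2 * x ^+ n *+ 'C(n.+2, 2)
    + a ^+ 3 * r.
Proof.
elim: n => [|n [r IHn]].
  by exists 0; rewrite mulr0 addr0 binn !expr2 expr0 expr1; ring.
exists ((a + x) * r + x ^+ n *+ 'C(n.+2, 2)).
rewrite exprS IHn (binS n.+2 1) bin1 !exprS.
by move: 'C(n.+2, 2) => c; ring.
Qed.

(** Oddness of [n] gives both the sign that cancels the constant term and the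
    divisibility of ['C(n, 2)] by [n] that kills the quadratic one. *)
Lemma pair_expr_odd n (x : int) : odd n ->
  (n%:Z ^+ 3 %| x ^+ n + (n%:Z - x) ^+ n - n%:Z ^+ 2 * x ^+ n.-1)%Z.
Proof.
case: n => [|[|n]] //.
move=> n_odd; have [r ->] := exprDn_order2 n.+2%:Z (- x) n.
have /dvdnP[c ->] : (n.+2 %| 'C(n.+2, 2))%N.
  by rewrite bin2odd // dvdn_mulr.
have En : (- x) ^+ n = - x ^+ n.
  by move: n_odd; rewrite exprNn -signr_odd /= negbK => ->; rewrite mulN1r.
set N := n.+2%:Z.
apply/dvdzP; exists (r - x ^+ n *+ c).
rewrite !exprS En -(mulr_natr _ n.+2) -(mulr_natr _ (c * n.+2)) natrM natz -/N.
ring.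
Qed.

Lemma double_power_sum_odd n : odd n ->
  (n%:Z ^+ 3 %| 2 * (power_sum n n)%:Z - n%:Z ^+ 2 * (power_sum n.-1 n)%:Z)%Z.
Proof.
move=> n_odd; rewrite double_power_sum power_sumZ mulr_sumr -sumrB.
by apply: rpred_sum => i _; exact: pair_expr_odd.
Qed.

(** For odd [k], [i ^ k + (n - i) ^ k] is divisible by [i + (n - i)]. *)
Lemma dvd_double_power_sum k n : odd k -> (n%:Z %| 2 * (power_sum k n)%:Z)%Z.
Proof.
move=> k_odd; rewrite double_power_sum; apply: rpred_sum => i _.
have -> : i%:Z ^+ k = - (- i%:Z) ^+ k.
  by rewrite exprNn -signr_odd k_odd mulN1r opprK.
by rewrite addrC subrXX opprK subrK dvdz_mulr.
Qed.

Lemma sum_odd n : (\sum_(1 <= i < n) odd i = n./2)%N.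
Proof.
elim: n => [|[|n] IHn]; [by rewrite big_geq.. | rewrite big_nat_recr //= IHn].
by rewrite -uphalfE uphalf_half; case: (odd n); rewrite ?addn0 ?addn1 ?add1n.
Qed.

(** Odd bases: Euler's theorem, as [totient (2 ^ s)] divides [2 ^ s], hence [n].
    Even bases: [2 ^ n] divides [i ^ n], and [s < 2 ^ s <= n]. *)
Lemma expn_mod_pow2 s n i : (2 ^ s %| n)%N -> (0 < n)%N ->
  (i ^ n = odd i %[mod 2 ^ s])%N.
Proof.
move=> s_dvd_n n_gt0; case: (boolP (odd i)) => i_odd /=.
  have /dvdnP[c ->] : (totient (2 ^ s) %| n)%N.
    apply: dvdn_trans s_dvd_n; case: s => [|s] //.
    by rewrite totient_pfactor //= mul1n dvdn_exp2l.
  have co_i : coprime i (2 ^ s) by rewrite coprimeXr // coprimen2.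
  by rewrite mulnC expnM -modnXm (Euler_exp_totient co_i) modnXm exp1n.
apply/eqP; rewrite mod0n; apply: (@dvdn_trans (2 ^ n)).
  by rewrite dvdn_exp2l // (leq_trans (ltnW (ltn_expl s (ltnSn 1)))) // dvdn_leq.
by rewrite dvdn_exp2r // dvdn2.
Qed.

(** Modulo [2 ^ s], with [s] the 2-adic valuation of [n], the sum counts the
    odd numbers below [n]; there are [n / 2] of them, and the valuation of
    [n / 2] is only [s - 1]. *)
Lemma power_sum_even_ndvd n :
  (0 < n)%N -> ~~ odd n -> ~~ (n %| power_sum n n)%N.
Proof.
move=> n_gt0 n_even; apply/negP => n_dvd.
have n_half : n = (2 * n./2)%N by rewrite mul2n even_halfK.
have half_gt0 : (0 < n./2)%N by rewrite half_gt0; case: (n) n_gt0 n_even => [|[]].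
set s := logn 2 n; have s_dvd_n : (2 ^ s %| n)%N by rewrite pfactor_dvdnn.
have sE : s = (logn 2 n./2).+1.
  by rewrite /s {1}n_half lognM // (@logn_prime 2 2).
have sum_mod : (power_sum n n = n./2 %[mod 2 ^ s])%N.
  rewrite -sum_odd /power_sum.
  elim/big_ind2: _ => // [a b c d ab cd | i _]; last exact: expn_mod_pow2.
  by rewrite -modnDm ab cd modnDm.
have : (2 ^ s %| n./2)%N by rewrite /dvdn -sum_mod; exact: dvdn_trans n_dvd.
by rewrite pfactor_dvdn // sE ltnn.
Qed.

Lemma congruence_equiv_odd n : odd n ->
  ((power_sum n.-1 n)%:Z = - 1 %[mod n%:Z])%Z <->
  (2 * (power_sum n n)%:Z = - n%:Z ^+ 2 %[mod n%:Z ^+ 3])%Z.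
Proof.
move=> n_odd.
have n2_neq0 : n%:Z ^+ 2 != 0 by rewrite expf_neq0 //; case: n n_odd.
suff E : (n%:Z %| (power_sum n.-1 n)%:Z - - 1)%Z =
         (n%:Z ^+ 3 %| 2 * (power_sum n n)%:Z - - n%:Z ^+ 2)%Z.
  split=> /eqP; rewrite eqz_mod_dvd => ?; apply/eqP; rewrite eqz_mod_dvd.
    by rewrite -E.
  by rewrite E.
rewrite -(dvdz_mul2l n2_neq0) -exprSr.
(* Adding [2 S_n(n) - n ^ 2 S_(n-1)(n)] does not affect divisibility. *)
rewrite -(rpredDl _ (double_power_sum_odd n_odd)); congr (_ %| _)%Z.
ring.
Qed.

Lemma even_halfZ n : ~~ odd n -> n%:Z = 2 * n./2%:Z.
Proof. by move=> n_even; rewrite -[in LHS](even_halfK n_even) -mul2n PoszM. Qed.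

Lemma not_congruence_pred_even n : (3 <= n)%N -> ~~ odd n ->
  ~ ((power_sum n.-1 n)%:Z = - 1 %[mod n%:Z])%Z.
Proof.
move=> n_ge3 n_even /eqP; rewrite eqz_mod_dvd opprK => n_dvd.
have n_half := even_halfZ n_even.
have half_dvd : (n./2%:Z %| (power_sum n.-1 n)%:Z)%Z.
  have := @dvd_double_power_sum n.-1 n; rewrite n_half dvdz_mul2l //; apply.
  by case: n n_ge3 n_even {n_dvd n_half} => //= n _; rewrite negbK.
have : (n./2%:Z %| (power_sum n.-1 n)%:Z + 1)%Z.
  by apply: dvdz_trans n_dvd; rewrite n_half dvdz_mull.
rewrite rpredDl // dvdz1 absz_nat => /eqP half1.
by move: n_ge3; rewrite -(even_halfK n_even) half1.
Qed.

Lemma not_congruence_cube_even n : (3 <= n)%N -> ~~ odd n ->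
  ~ (2 * (power_sum n n)%:Z = - n%:Z ^+ 2 %[mod n%:Z ^+ 3])%Z.
Proof.
move=> n_ge3 n_even /eqP; rewrite eqz_mod_dvd opprK => n3_dvd.
have n_half := even_halfZ n_even.
have := power_sum_even_ndvd (ltn_trans (isT : 0 < 2)%N n_ge3) n_even.
move/negP; apply.
(* Weakening the modulus to [n ^ 2 = 4 (n / 2) ^ 2] leaves
   [n | 2 (n / 2) ^ 2 | S_n(n)]. *)
have : (n%:Z ^+ 2 %| 2 * (power_sum n n)%:Z + n%:Z ^+ 2)%Z.
  by apply: dvdz_trans n3_dvd; rewrite exprS dvdz_mull.
rewrite rpredDr // {1}n_half exprMn -[2 ^+ 2]/(2 * 2 : int) -mulrA dvdz_mul2l //.
move=> half_dvd; suff : (n%:Z %| (power_sum n n)%:Z)%Z by [].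
by apply: dvdz_trans half_dvd; rewrite n_half expr2 mulrA dvdz_mulr.
Qed.

Theorem proposition2p2 :
  (forall n : nat, (3 <= n)%N ->
     (prime n <->
      ((power_sum n.-1 n)%:Z = - 1 %[mod n%:Z])%Z))
  <->
  (forall n : nat, (3 <= n)%N ->
     (prime n <->
      (2 * (power_sum n n)%:Z = - n%:Z ^+ 2 %[mod n%:Z ^+ 3])%Z)).
Proof.
suff E n : (3 <= n)%N ->
    ((power_sum n.-1 n)%:Z = - 1 %[mod n%:Z])%Z <->
    (2 * (power_sum n n)%:Z = - n%:Z ^+ 2 %[mod n%:Z ^+ 3])%Z.
  by split=> H n n_ge3; have := H n n_ge3; have := E n n_ge3; tauto.
move=> n_ge3; have [n_odd | n_even] := boolP (odd n).
  exact: congruence_equiv_odd.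
have := not_congruence_pred_even n_ge3 n_even.
have := not_congruence_cube_even n_ge3 n_even.
by tauto.
Qed.
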